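(* Let $(M,g)$ be a Riemannian manifold, let $\psi\in\mathrm{Aut}(TM)$ and let $h:=g^\psi=g(\psi^{-1}\cdot,\psi^{-1}\cdot)$. Let $\nabla^g$ and $\nabla^h$ be the Levi-Civita connections of $g$ and $h$. Then for all vector fields $X,Y,Z$ on $M$, \begin{align*} 2h(\nabla^h_XY,Z)&=2h(\nabla^g_XY,Z)+h(\psi(\nabla^g_X\psi^{-1})Y,Z)+h(\psi(\nabla^g_Y\psi^{-1})X,Z)\\ &\quad+h(\psi(\nabla^g_X\psi^{-1})Z,Y)-h(\psi(\nabla^g_Z\psi^{-1})X,Y)\\ &\quad+h(\psi(\nabla^g_Y\psi^{-1})Z,X)-h(\psi(\nabla^g_Z\psi^{-1})Y,X). \end{align*} In particular, if $(\nabla^g_X\psi^{-1})Y=(\nabla^g_Y\psi^{-1})X$ for all vector fields $X,Y$, then $$\nabla^h_XY=\psi\nabla^g_X(\psi^{-1}Y)$$ for all vector fields $X,Y$.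
   Context: $\mathrm{Aut}(TM)$ denotes the smooth vector bundle automorphisms of $TM$ covering the identity of $M$. For $\psi\in\mathrm{Aut}(TM)$, $(\nabla^g_X\psi^{-1})Y:=\nabla^g_X(\psi^{-1}Y)-\psi^{-1}(\nabla^g_XY)$. *)

(* Defs.v *)
From HB Require Import structures.
From mathcomp Require Import all_boot all_order all_algebra.
From mathcomp Require Import mathcomp_extra boolp classical_sets functions.
From mathcomp Require Import cardinality reals topology normedtype derive.
From mathcomp Require Import ring.

Set Implicit Arguments.
Unset Strict Implicit.
Unset Printing Implicit Defensive.

Import Order.TTheory GRing.Theory Num.Theory.
Import numFieldNormedType.Exports.

Local Open Scope classical_set_scope.
Local Open Scope ring_scope.

Section EuclideanSmoothness.
Variables (R : realType) (n : nat).
Implicit Types (U : set 'rV[R]_n) (f g : 'rV[R]_n -> R).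

Definition partial (i : 'I_n) f : 'rV[R]_n -> R := 'D_(delta_mx 0 i) f.

(* All partial derivatives of order at most k exist and are continuous on U. *)
Fixpoint Ck (k : nat) U f : Prop :=
  (forall x, U x -> {for x, continuous f}) /\
  match k with
  | 0 => True
  | k'.+1 => forall i,
      (forall x, U x -> derivable f x (delta_mx 0 i)) /\ Ck k' U (partial i f)
  end.

Definition smooth_on U f := forall k, Ck k U f.

Lemma Ck_continuous k U f x : Ck k U f -> U x -> {for x, continuous f}.
Proof. by case: k => [|k] [+ _]; apply. Qed.

Lemma CkW k U f : Ck k.+1 U f -> Ck k U f.
Proof.
elim: k f => [|k IH] f [cf df]; split => // i.
by have [df1 df2] := df i; split => //; exact: IH.
Qed.

Lemma Ck_congr k U f g : open U -> (forall x, U x -> f x = g x) ->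
  Ck k U f -> Ck k U g.
Proof.
move=> oU; have near_fg f' g' x : (forall x, U x -> f' x = g' x) -> U x ->
    \forall y \near x, f' y = g' y.
  by move=> fg Ux; near=> y; apply: fg; near: y; exact: open_nbhs_nbhs.
have cont f' g' : (forall x, U x -> f' x = g' x) ->
    (forall x, U x -> {for x, continuous f'}) ->
    (forall x, U x -> {for x, continuous g'}).
  move=> fg cf x Ux; rewrite /prop_for /continuous_at -(fg _ Ux).
  exact: cvg_trans (near_eq_cvg (F := nbhs x) (near_fg _ _ _ fg Ux)) (cf x Ux).
elim: k f g => [|k IH] f g fg [cf df]; split => //; try exact: cont cf.
move=> i; have [df1 df2] := df i; split.
  by move=> x Ux; apply: near_eq_derivable (df1 x Ux); exact: near_fg.
by apply: IH df2 => x Ux; apply: near_eq_derive; exact: near_fg.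
Unshelve. all: by end_near. Qed.

Lemma Ck_cst k U (a : R) : Ck k U (cst a).
Proof.
elim: k a => [|k IH] a; split => //; try by move=> x _; exact: cst_continuous.
move=> i; split=> [x _|]; first exact: derivable_cst.
rewrite (_ : partial i _ = cst 0) //.
by apply/funext => x; rewrite /partial derive_cst.
Qed.

Lemma CkD k U f g : open U -> Ck k U f -> Ck k U g -> Ck k U (f \+ g).
Proof.
move=> oU; elim: k f g => [|k IH] f g [cf df] [cg dg]; split => //;
  try by move=> x Ux; apply: continuousD; [exact: cf|exact: cg].
move=> i; have [df1 df2] := df i; have [dg1 dg2] := dg i; split.
  by move=> x Ux; apply: derivableD; [exact: df1|exact: dg1].
apply: (Ck_congr oU _ (IH _ _ df2 dg2)) => x Ux.
by rewrite /partial deriveD //; [exact: df1|exact: dg1].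
Qed.

Lemma CkM k U f g : open U -> Ck k U f -> Ck k U g -> Ck k U (f \* g).
Proof.
move=> oU; elim: k f g => [|k IH] f g fk gk; have [cf df] := fk;
  have [cg dg] := gk; split => //;
  try by move=> x Ux; apply: continuousM; [exact: cf|exact: cg].
move=> i; have [df1 df2] := df i; have [dg1 dg2] := dg i; split.
  by move=> x Ux; apply: derivableM; [exact: df1|exact: dg1].
apply: (Ck_congr oU _ (CkD oU (IH _ _ (CkW fk) dg2) (IH _ _ (CkW gk) df2))).
by move=> x Ux; rewrite /partial deriveM //; [exact: df1|exact: dg1].
Qed.

Lemma smooth_congr U f g : open U -> (forall x, U x -> f x = g x) ->
  smooth_on U f -> smooth_on U g.
Proof. by move=> oU fg fs k; exact: Ck_congr (fs k). Qed.

Lemma smooth_cst U (a : R) : smooth_on U (cst a).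
Proof. by move=> k; exact: Ck_cst. Qed.

Lemma smoothD U f g : open U -> smooth_on U f -> smooth_on U g ->
  smooth_on U (f \+ g).
Proof. by move=> oU fs gs k; exact: CkD. Qed.

Lemma smoothM U f g : open U -> smooth_on U f -> smooth_on U g ->
  smooth_on U (f \* g).
Proof. by move=> oU fs gs k; exact: CkM. Qed.

Lemma smooth_sum (I : Type) (r : seq I) (F : I -> 'rV[R]_n -> R) U : open U ->
  (forall i, smooth_on U (F i)) -> smooth_on U (fun x => \sum_(i <- r) F i x).
Proof.
move=> oU Fs; elim: r => [|i r IH].
  by apply: (smooth_congr oU _ (smooth_cst _ 0)) => x _; rewrite big_nil.
by apply: (smooth_congr oU _ (smoothD oU (Fs i) IH)) => x _; rewrite big_cons.
Qed.

Lemma smooth_partial U f i : smooth_on U f -> smooth_on U (partial i f).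
Proof. by move=> fs k; have [_ /(_ i)[]] := fs k.+1. Qed.

Lemma smooth_derivable U f x i : smooth_on U f -> U x ->
  derivable f x (delta_mx 0 i).
Proof. by move=> fs; have [_ /(_ i)[+ _]] := fs 1%N; apply. Qed.

End EuclideanSmoothness.

(* A homeomorphism between open subsets of T and R^n; the values of chart_map *)
(* off chart_dom, and of chart_inv off the image, are irrelevant.             *)
Record chart (R : realType) (n : nat) (T : topologicalType) := Chart {
  chart_dom : set T;
  chart_map :> T -> 'rV[R]_n;
  chart_inv : 'rV[R]_n -> T;
  chart_dom_open : open chart_dom;
  chart_cod_open : open (chart_map @` chart_dom);
  chart_mapK : {in chart_dom, cancel chart_map chart_inv};
  chart_map_cts : {within chart_dom, continuous chart_map};
  chart_inv_cts : {within chart_map @` chart_dom, continuous chart_inv} }.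

Arguments chart_cod_open {R n T} c : rename.

Definition chart_cod (R : realType) (n : nat) (T : topologicalType)
  (c : chart R n T) : set 'rV[R]_n := c @` chart_dom c.

(* The atlas need not be maximal. *)
Record smooth_manifold (R : realType) (n : nat) := SmoothManifold {
  carrier :> topologicalType;
  manifold_hausdorff : hausdorff_space carrier;
  manifold_second_countable : @second_countable carrier;
  atlas : set (chart R n carrier);
  atlas_cover : forall p, exists2 c, atlas c & chart_dom c p;
  atlas_compatible : forall c c' (j : 'I_n), atlas c -> atlas c' ->
    smooth_on (c @` (chart_dom c `&` chart_dom c'))
              (fun x => c' (chart_inv c x) 0 j) }.

Section SmoothFunctions.
Variables (R : realType) (n : nat) (M : smooth_manifold R n).

Definition is_smooth (f : M -> R) :=
  forall c, atlas c -> smooth_on (chart_cod c) (f \o chart_inv c).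

Definition smooth_pred : pred (M -> R) := fun f => `[< is_smooth f >].

Record Cinf := MkCinf {
  Cinf_fun :> M -> R;
  Cinf_smooth : smooth_pred Cinf_fun }.

HB.instance Definition _ := [isSub for Cinf_fun].
HB.instance Definition _ := [Choice of Cinf by <:].

Lemma CinfP (f : Cinf) : is_smooth f.
Proof. exact/asboolP/Cinf_smooth. Qed.

Lemma smooth_pred_subring : subring_closed smooth_pred.
Proof.
split=> [|f g /asboolP fs /asboolP gs|f g /asboolP fs /asboolP gs];
  apply/asboolP => c Ac; have oc := chart_cod_open c.
- exact: smooth_cst.
- apply: (smooth_congr oc _ (smoothD oc (fs c Ac)
    (smoothM oc (smooth_cst _ (-1)) (gs c Ac)))).
  by move=> x _ /=; rewrite mulN1r.
- exact: (smooth_congr oc _ (smoothM oc (fs c Ac) (gs c Ac))).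
Qed.

Lemma smooth_pred_submod : subsemimod_closed smooth_pred.
Proof.
have [s1 sB _] := smooth_pred_subring.
have s0 : 0 \in smooth_pred by rewrite -(subrr 1); exact: sB.
split; first split=> // f g fs gs.
  by rewrite -[g]opprK; apply: (sB) => //; rewrite -sub0r; exact: sB.
move=> a f /asboolP fs; apply/asboolP => c Ac; have oc := chart_cod_open c.
exact: (smooth_congr oc _ (smoothM oc (smooth_cst _ a) (fs c Ac))).
Qed.

HB.instance Definition _ :=
  GRing.SubChoice_isSubComPzRing.Build (M -> R) smooth_pred Cinf
    smooth_pred_subring.
HB.instance Definition _ :=
  GRing.SubZmodule_isSubLmodule.Build R (M -> R) smooth_pred Cinf
    smooth_pred_submod.

End SmoothFunctions.

Section TangentSpaces.
Variables (R : realType) (n : nat) (M : smooth_manifold R n).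

Definition is_derivation (p : M) (v : Cinf M -> R) :=
  (forall a f g, v (a *: f + g) = a * v f + v g) /\
  (forall f g, v (f * g) = v f * g p + f p * v g).

Definition derivation_pred p : pred (Cinf M -> R) :=
  fun v => `[< is_derivation p v >].

Record tangent (p : M) := MkTangent {
  tangent_fun :> Cinf M -> R;
  tangent_derivation : derivation_pred p tangent_fun }.

HB.instance Definition _ p := [isSub for @tangent_fun p].
HB.instance Definition _ p := [Choice of tangent p by <:].

Lemma tangentP p (v : tangent p) : is_derivation p v.
Proof. exact/asboolP/tangent_derivation. Qed.

Lemma derivation_submod p : subsemimod_closed (derivation_pred p).
Proof.
split; first split.
- apply/asboolP; split=> [a f g|f g].
    by rewrite mulr0 addr0.
  by rewrite mul0r mulr0 addr0.
- move=> v w /asboolP[v1 v2] /asboolP[w1 w2].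
  have E h : (v + w) h = v h + w h by [].
  apply/asboolP; split=> [a f g|f g]; rewrite !E.
    by rewrite v1 w1 mulrDr addrACA.
  by rewrite v2 w2 mulrDl mulrDr addrACA.
- move=> a v /asboolP[v1 v2].
  have E h : (a *: v) h = a * v h by [].
  apply/asboolP; split=> [b f g|f g]; rewrite !E.
    by rewrite v1 mulrDr mulrCA.
  by rewrite v2 mulrDr mulrA mulrCA.
Qed.

HB.instance Definition _ p :=
  GRing.SubChoice_isSubLmodule.Build R (Cinf M -> R) (derivation_pred p)
    (tangent p) (derivation_submod p).

Lemma tangent_ext p (v w : tangent p) : (forall f, v f = w f) -> v = w.
Proof. by move=> vw; apply: val_inj; exact/funext. Qed.

Lemma tangent_addE p (v w : tangent p) f : (v + w) f = v f + w f.
Proof. by []. Qed.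

Lemma tangent_scaleE p a (v : tangent p) f : (a *: v) f = a * v f.
Proof. by []. Qed.

Lemma tangent_sumE p (I : Type) (r : seq I) (v : I -> tangent p) f :
  (\sum_(i <- r) v i) f = \sum_(i <- r) v i f.
Proof. by elim: r => [|i r IH]; rewrite ?big_nil // !big_cons -IH. Qed.

(* The i-th coordinate vector of the chart c at p, set to 0 when p lies       *)
(* outside the domain of c.                                                   *)
Definition coord_fun (c : chart R n M) (i : 'I_n) (p : M) (f : Cinf M) : R :=
  if `[< atlas c /\ chart_dom c p >] then partial i (f \o chart_inv c) (c p)
  else 0.

Lemma chart_cod_map (c : chart R n M) p : chart_dom c p -> chart_cod c (c p).
Proof. by move=> cp; exists p. Qed.

Lemma chart_mapK_dom (c : chart R n M) p : chart_dom c p ->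
  chart_inv c (c p) = p.
Proof. by move=> cp; apply: chart_mapK; rewrite inE. Qed.

Lemma coord_derivation c i p : derivation_pred p (coord_fun c i p).
Proof.
apply/asboolP; rewrite /coord_fun; case: asboolP => [[Ac cp]|_]; last first.
  by split=> [a f g|f g]; rewrite ?mulr0 ?mul0r addr0.
have df (f : Cinf M) : derivable (f \o chart_inv c) (c p) (delta_mx 0 i).
  exact: smooth_derivable (CinfP f Ac) (chart_cod_map cp).
split=> [a f g|f g]; rewrite /partial.
  rewrite (_ : _ \o _ = a \*: (f \o chart_inv c) + (g \o chart_inv c)) //.
  by rewrite deriveD ?deriveZ //; exact: derivableZ.
rewrite (_ : _ \o _ = (f \o chart_inv c) * (g \o chart_inv c)) //.
rewrite deriveM //= chart_mapK_dom // addrC.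
by congr (_ + _); exact: mulrC.
Qed.

Definition coord_vec c i p : tangent p := MkTangent (coord_derivation c i p).

Lemma coord_vecE c i p (f : Cinf M) : atlas c -> chart_dom c p ->
  coord_vec c i p f = partial i (f \o chart_inv c) (c p).
Proof. by move=> Ac cp; rewrite /= /coord_fun asboolT. Qed.

End TangentSpaces.

Section VectorFields.
Variables (R : realType) (n : nat) (M : smooth_manifold R n).

Definition smooth_field (X : forall p : M, tangent p) :=
  forall c, atlas c -> exists2 a : 'I_n -> 'rV[R]_n -> R,
    forall i, smooth_on (chart_cod c) (a i) &
    forall p, chart_dom c p -> X p = \sum_(i < n) a i (c p) *: coord_vec c i p.

Record vector_field := MkVectorField {
  field_fun :> forall p : M, tangent p;
  field_smooth : smooth_field field_fun }.

Implicit Types (X Y Z : vector_field) (f : Cinf M).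

Lemma field_ext X Y : (forall p, X p = Y p) -> X = Y.
Proof.
case: X Y => [X Xs] [Y Ys] /= XY.
have E : X = Y by exact: functional_extensionality_dep.
by case: _ / E Ys => Ys; congr MkVectorField; exact: Prop_irrelevance.
Qed.

Lemma field0_smooth : smooth_field (fun p => 0).
Proof.
move=> c Ac; exists (fun _ => cst 0) => [i|p cp]; first exact: smooth_cst.
by rewrite big1 // => i _; rewrite scale0r.
Qed.

Lemma fieldD_smooth X Y : smooth_field (fun p => X p + Y p).
Proof.
move=> c Ac; have [a as_ Xa] := field_smooth X Ac.
have [b bs Yb] := field_smooth Y Ac.
exists (fun i => a i \+ b i) => [i|p cp].
  exact: smoothD (chart_cod_open c) (as_ i) (bs i).
rewrite Xa // Yb // -big_split.
by apply: eq_bigr => i _; rewrite scalerDl.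
Qed.

Lemma fieldZ_smooth f X : smooth_field (fun p => f p *: X p).
Proof.
move=> c Ac; have [a as_ Xa] := field_smooth X Ac.
exists (fun i => (f \o chart_inv c) \* a i) => [i|p cp].
  exact: smoothM (chart_cod_open c) (CinfP f Ac) (as_ i).
rewrite Xa // scaler_sumr; apply: eq_bigr => i _.
by rewrite scalerA /= chart_mapK_dom.
Qed.

Lemma fieldN_smooth X : smooth_field (fun p => - X p).
Proof.
have := fieldZ_smooth (-1) X; congr smooth_field.
by apply: functional_extensionality_dep => p; exact: scaleN1r.
Qed.

HB.instance Definition _ := gen_eqMixin vector_field.
HB.instance Definition _ := gen_choiceMixin vector_field.

Let addA : associative (fun X Y => MkVectorField (fieldD_smooth X Y)).
Proof. by move=> X Y Z; apply: field_ext => p; exact: addrA. Qed.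
Let addC : commutative (fun X Y => MkVectorField (fieldD_smooth X Y)).
Proof. by move=> X Y; apply: field_ext => p; exact: addrC. Qed.
Let add0 : left_id (MkVectorField field0_smooth)
  (fun X Y => MkVectorField (fieldD_smooth X Y)).
Proof. by move=> X; apply: field_ext => p; exact: add0r. Qed.
Let addN : left_inverse (MkVectorField field0_smooth)
  (fun X => MkVectorField (fieldN_smooth X))
  (fun X Y => MkVectorField (fieldD_smooth X Y)).
Proof. by move=> X; apply: field_ext => p; exact: addNr. Qed.

HB.instance Definition _ :=
  GRing.isZmodule.Build vector_field addA addC add0 addN.

Let fieldZ f X := MkVectorField (fieldZ_smooth f X).
Let scaleA f g X : fieldZ f (fieldZ g X) = fieldZ (f * g) X.
Proof. by apply: field_ext => p; exact: scalerA. Qed.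
Let scale1 : left_id 1 fieldZ.
Proof. by move=> X; apply: field_ext => p; exact: scale1r. Qed.
Let scaleDr : right_distributive fieldZ +%R.
Proof. by move=> f X Y; apply: field_ext => p; exact: scalerDr. Qed.
Let scaleDl X : {morph fieldZ^~ X : f g / f + g}.
Proof. by move=> f g; apply: field_ext => p; exact: scalerDl. Qed.

HB.instance Definition _ :=
  GRing.Zmodule_isLmodule.Build (Cinf M) vector_field
    scaleA scale1 scaleDr scaleDl.

Lemma fieldDE X Y p : (X + Y) p = X p + Y p. Proof. by []. Qed.
Lemma fieldNE X p : (- X) p = - X p. Proof. by []. Qed.
Lemma fieldZE f X p : (f *: X) p = f p *: X p. Proof. by []. Qed.

Lemma field_act_smooth X f : smooth_pred (fun p => X p f).
Proof.
apply/asboolP => c Ac; have [a as_ Xa] := field_smooth X Ac.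
have oc := chart_cod_open c.
apply: (smooth_congr oc _ (smooth_sum (index_enum 'I_n) oc (fun i =>
  smoothM oc (as_ i) (smooth_partial i (CinfP f Ac))))).
move=> _ [p cp <-] /=; rewrite chart_mapK_dom // Xa // tangent_sumE.
by apply: eq_bigr => i _; rewrite tangent_scaleE coord_vecE.
Qed.

Definition field_act X f : Cinf M := MkCinf (field_act_smooth X f).

Definition lie_bracket_fun X Y (p : M) (f : Cinf M) : R :=
  X p (field_act Y f) - Y p (field_act X f).

Lemma field_act_lin X a f g :
  field_act X (a *: f + g) = a *: field_act X f + field_act X g.
Proof. by apply/val_inj/funext => p; case: (tangentP (X p)) => /(_ a f g). Qed.

Lemma field_act_mul X f g :
  field_act X (f * g) = field_act X f * g + f * field_act X g.
Proof. by apply/val_inj/funext => p; case: (tangentP (X p)) => _ /(_ f g). Qed.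

Lemma tangent_add p (v : tangent p) (f g : Cinf M) : v (f + g) = v f + v g.
Proof. by have [+ _] := tangentP v => /(_ 1 f g); rewrite scale1r mul1r. Qed.

Lemma lie_bracket_derivation X Y p : derivation_pred p (lie_bracket_fun X Y p).
Proof.
have [Xl Xm] := tangentP (X p); have [Yl Ym] := tangentP (Y p).
apply/asboolP; split=> [a f g|f g]; rewrite /lie_bracket_fun.
  by rewrite !field_act_lin Xl Yl mulrBr opprD addrACA.
rewrite !field_act_mul !tangent_add !Xm !Ym /=.
ring.
Qed.

(* [X, Y] as a plain section of the tangent spaces: its smoothness is not     *)
(* needed to express that a connection is torsion-free.                       *)
Definition lie_bracket X Y (p : M) : tangent p :=
  MkTangent (lie_bracket_derivation X Y p).

End VectorFields.

Section RiemannianMetrics.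
Variables (R : realType) (n : nat) (M : smooth_manifold R n).

Record riemannian_metric := MkMetric {
  metric_fun :> forall p : M, tangent p -> tangent p -> R;
  metric_linear : forall p a (u v w : tangent p),
    metric_fun (a *: u + v) w = a * metric_fun u w + metric_fun v w;
  metric_sym : forall p (v w : tangent p), metric_fun v w = metric_fun w v;
  metric_pos : forall p (v : tangent p), v != 0 -> 0 < metric_fun v v;
  metric_smooth : forall c i j, atlas c ->
    smooth_on (chart_cod c)
      (fun x => metric_fun (coord_vec c i (chart_inv c x))
                           (coord_vec c j (chart_inv c x))) }.

Lemma metricDl (g : riemannian_metric) p (u v w : tangent p) :
  g p (u + v) w = g p u w + g p v w.
Proof. by rewrite -[u]scale1r metric_linear mul1r scale1r. Qed.

Lemma metric0l (g : riemannian_metric) p (w : tangent p) : g p 0 w = 0.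
Proof. by apply: (addIr (g p 0 w)); rewrite -metricDl !add0r. Qed.

Lemma metricZl (g : riemannian_metric) p a (v w : tangent p) :
  g p (a *: v) w = a * g p v w.
Proof. by rewrite -[a *: v]addr0 metric_linear metric0l addr0. Qed.

Lemma metric_suml (g : riemannian_metric) p (I : Type) (r : seq I)
    (v : I -> tangent p) w :
  g p (\sum_(i <- r) v i) w = \sum_(i <- r) g p (v i) w.
Proof.
elim: r => [|i r IH]; first by rewrite !big_nil metric0l.
by rewrite !big_cons metricDl IH.
Qed.

Lemma metric_sum2 (g : riemannian_metric) p (a b : 'I_n -> R)
    (v w : 'I_n -> tangent p) :
  g p (\sum_i a i *: v i) (\sum_j b j *: w j) =
  \sum_i \sum_j a i * (b j * g p (v i) (w j)).
Proof.
rewrite metric_suml; apply: eq_bigr => i _.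
rewrite metricZl metric_sym metric_suml mulr_sumr.
by apply: eq_bigr => j _; rewrite metricZl metric_sym.
Qed.

Lemma metric_eval_smooth (g : riemannian_metric) (X Y : vector_field M) :
  smooth_pred (fun p => g p (X p) (Y p)).
Proof.
apply/asboolP => c Ac; have [a as_ Xa] := field_smooth X Ac.
have [b bs Yb] := field_smooth Y Ac; have oc := chart_cod_open c.
apply: (smooth_congr oc _ (smooth_sum (index_enum 'I_n) oc (fun i =>
  smooth_sum (index_enum 'I_n) oc (fun j =>
  smoothM oc (as_ i) (smoothM oc (bs j) (metric_smooth g i j Ac)))))).
move=> _ [p cp <-] /=; rewrite chart_mapK_dom // Xa // Yb //.
by rewrite metric_sum2.
Qed.

(* The smooth function g(X, Y). *)
Definition metric_eval (g : riemannian_metric) (X Y : vector_field M) :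
  Cinf M :=
  MkCinf (metric_eval_smooth g X Y).

End RiemannianMetrics.

Section TangentAutomorphisms.
Variables (R : realType) (n : nat) (M : smooth_manifold R n).

(* In every chart, the matrix of A with respect to the coordinate vectors has *)
(* smooth entries.                                                            *)
Definition smooth_endo (A : forall p : M, tangent p -> tangent p) :=
  forall c, atlas c -> exists2 a : 'I_n -> 'I_n -> 'rV[R]_n -> R,
    forall i j, smooth_on (chart_cod c) (a i j) &
    forall p, chart_dom c p -> forall j,
      A p (coord_vec c j p) = \sum_(i < n) a i j (c p) *: coord_vec c i p.

Record tangent_aut := MkTangentAut {
  aut_fun :> forall p : M, {linear tangent p -> tangent p};
  aut_inv_fun : forall p : M, {linear tangent p -> tangent p};
  aut_funK : forall p, cancel (aut_fun p) (aut_inv_fun p);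
  aut_inv_funK : forall p, cancel (aut_inv_fun p) (aut_fun p);
  aut_smooth : smooth_endo aut_fun;
  aut_inv_smooth : smooth_endo aut_inv_fun }.

Definition aut_inv (psi : tangent_aut) : tangent_aut :=
  MkTangentAut (aut_inv_funK psi) (aut_funK psi)
    (aut_inv_smooth psi) (aut_smooth psi).

Lemma aut_field_smooth (psi : tangent_aut) (X : vector_field M) :
  smooth_field (fun p => psi p (X p)).
Proof.
move=> c Ac; have [a as_ Xa] := field_smooth X Ac.
have [m ms psim] := aut_smooth psi Ac; have oc := chart_cod_open c.
exists (fun i x => \sum_(j < n) a j x * m i j x) => [i|p cp].
  exact: (smooth_sum (index_enum 'I_n) oc (fun j =>
    smoothM oc (as_ j) (ms i j))).
rewrite Xa // linear_sum; under eq_bigr => j _ do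
  rewrite linearZ psim //= scaler_sumr.
rewrite exchange_big; apply: eq_bigr => i _ /=.
by rewrite scaler_suml; apply: eq_bigr => j _; rewrite scalerA.
Qed.

Definition aut_field (psi : tangent_aut) (X : vector_field M) :
  vector_field M := MkVectorField (aut_field_smooth psi X).

Lemma twist_linear (g : riemannian_metric M) (psi : tangent_aut) p a
    (u v w : tangent p) (phi := aut_inv psi p) :
  g p (phi (a *: u + v)) (phi w) =
  a * g p (phi u) (phi w) + g p (phi v) (phi w).
Proof. by rewrite linearP metric_linear. Qed.

Lemma twist_pos (g : riemannian_metric M) (psi : tangent_aut) p
    (v : tangent p) :
  v != 0 -> 0 < g p (aut_inv psi p v) (aut_inv psi p v).
Proof.
move=> v0; apply: metric_pos; apply: contra_neq v0 => v0.
by rewrite -[v](aut_inv_funK psi) /= v0 linear0.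
Qed.

Lemma twist_smooth (g : riemannian_metric M) (psi : tangent_aut) c i j :
  atlas c ->
  smooth_on (chart_cod c)
    (fun x => g _ (aut_inv psi _ (coord_vec c i (chart_inv c x)))
                  (aut_inv psi _ (coord_vec c j (chart_inv c x)))).
Proof.
move=> Ac; have [m ms psim] := aut_inv_smooth psi Ac.
have oc := chart_cod_open c.
apply: (smooth_congr oc _ (smooth_sum (index_enum 'I_n) oc (fun k =>
  smooth_sum (index_enum 'I_n) oc (fun l =>
  smoothM oc (ms k i) (smoothM oc (ms l j) (metric_smooth g k l Ac)))))).
move=> _ [p cp <-] /=; rewrite !psim ?chart_mapK_dom //.
by rewrite metric_sum2.
Qed.

(* g^psi = g(psi^-1 -, psi^-1 -) *)
Definition metric_twist (g : riemannian_metric M) (psi : tangent_aut) :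
  riemannian_metric M :=
  MkMetric (twist_linear g psi) (fun p v w => metric_sym g _ _)
    (twist_pos g psi) (twist_smooth g psi).

End TangentAutomorphisms.

Section Connections.
Variables (R : realType) (n : nat) (M : smooth_manifold R n).

Record connection := MkConnection {
  cov :> vector_field M -> vector_field M -> vector_field M;
  cov_linear : forall (f : Cinf M) X X' Y,
    cov (f *: X + X') Y = f *: cov X Y + cov X' Y;
  cov_additive : forall X Y Y', cov X (Y + Y') = cov X Y + cov X Y';
  cov_leibniz : forall X (f : Cinf M) Y,
    cov X (f *: Y) = field_act X f *: Y + f *: cov X Y }.

Definition torsion_free (nabla : connection) :=
  forall X Y p, (nabla X Y - nabla Y X) p = lie_bracket X Y p.

Definition metric_compatible (g : riemannian_metric M) (nabla : connection) :=
  forall X Y Z, field_act X (metric_eval g Y Z) =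
    metric_eval g (nabla X Y) Z + metric_eval g Y (nabla X Z).

Definition levi_civita (g : riemannian_metric M) (nabla : connection) :=
  torsion_free nabla /\ metric_compatible g nabla.

(* (nabla_X A) Y *)
Definition cov_aut (nabla : connection) (X : vector_field M)
    (A : tangent_aut M) (Y : vector_field M) : vector_field M :=
  nabla X (aut_field A Y) - aut_field A (nabla X Y).

End Connections.

(* Main.v *)
Require Import Defs.
From mathcomp Require Import all_boot all_order all_algebra.
From mathcomp Require Import reals.
From mathcomp Require Import boolp.

Set Implicit Arguments.
Unset Strict Implicit.
Unset Printing Implicit Defensive.

Import GRing.Theory.
Local Open Scope ring_scope.

(** Let [phi] be the inverse of [psi], [A(X, Y) = (nabla_g_X phi) Y] and
    [D(X, Y) = nabla_h_X Y - nabla_g_X Y].  Both connections have the same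
    torsion, so [D] is symmetric ([torsion_free_diff_sym]).  Neither the Lie
    bracket nor any derivative of a metric therefore survives in the argument,
    which replaces the two Koszul formulas by one computation with [D].

    As [h(Y, Z) = g(phi Y, phi Z)] and [nabla_g] is compatible with [g],
    differentiating [h(Y, Z)] along [X] with [nabla_g] leaves the error
    [h(psi A(X, Y), Z) + h(psi A(X, Z), Y)] ([twist_derivative]), while
    [nabla_h] leaves none.  Comparing the two expressions of [X (h(Y, Z))],
    [[
      h(D(X, Y), Z) + h(D(X, Z), Y) = h(psi A(X, Y), Z) + h(psi A(X, Z), Y).
    ]]
    So [h(D(X, Y), Z)] is symmetric in [X, Y] and its symmetrization in [Y, Z]
    is known; the alternating sum over the three choices of the first argument
    isolates it ([koszul_polarization]), which is the stated formula.

    If [A] is symmetric, the right-hand side collapses to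
    [2 h(psi A(X, Y), Z)].  As [h] is nondegenerate ([metric_eval_eq0]), this
    gives [D(X, Y) = psi A(X, Y)], and
    [nabla_g_X Y + psi A(X, Y) = psi (nabla_g_X (phi Y))]. *)

(** The algebra behind the Koszul formula and the uniqueness of the
    Levi-Civita connection: the transpositions of the first two and of the last
    two arguments generate the permutations of the three arguments, so
    knowing how [d] behaves under each of the two determines [d] up to
    2-torsion. *)
Lemma koszul_polarization (V : Type) (W : zmodType) (d b : V -> V -> V -> W) :
  (forall x y z, d x y z = d y x z) ->
  (forall x y z, d x y z + d x z y = b x y z) ->
  forall x y z, d x y z *+ 2 = b x y z + b y x z - b z x y.
Proof.
move=> dC db x y z.
rewrite -!db [d y x z]dC [d z x y]dC [d z y x]dC.
by rewrite addrACA addrK mulr2n.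
Qed.

Lemma Cinf_mulr2n_inj (R : realType) (n : nat) (M : smooth_manifold R n)
    (f f' : Cinf M) : f *+ 2 = f' *+ 2 -> f = f'.
Proof.
move=> ff'; apply/val_inj/funext => p.
apply: (@Num.Theory.pmulrnI R 2) => //.
exact: (congr1 (fun k : Cinf M => k p) ff').
Qed.

Section MetricEval.
Variables (R : realType) (n : nat) (M : smooth_manifold R n).
Variable g : riemannian_metric M.
Implicit Types X Y Z : vector_field M.

Lemma metric_evalC X Y : metric_eval g X Y = metric_eval g Y X.
Proof. by apply/val_inj/funext => p; exact: metric_sym. Qed.

Lemma metric_evalDl X Y Z :
  metric_eval g (X + Y) Z = metric_eval g X Z + metric_eval g Y Z.
Proof. by apply/val_inj/funext => p; exact: metricDl. Qed.

Lemma metric_evalBl X Y Z :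
  metric_eval g (X - Y) Z = metric_eval g X Z - metric_eval g Y Z.
Proof. by apply: (addIr (metric_eval g Y Z)); rewrite -metric_evalDl !subrK. Qed.

Lemma metric_eval_eq0 X : metric_eval g X X = 0 -> X = 0.
Proof.
move=> gX0; apply: field_ext => p; apply/eqP/negPn/negP => /(metric_pos g).
have -> : g p (X p) (X p) = metric_eval g X X p by [].
by rewrite gX0 Order.POrderTheory.ltxx.
Qed.

End MetricEval.

Section Twist.
Variables (R : realType) (n : nat) (M : smooth_manifold R n).
Implicit Types (X Y Z : vector_field M) (psi : tangent_aut M).

Lemma aut_fieldB psi X Y :
  aut_field psi (X - Y) = aut_field psi X - aut_field psi Y.
Proof. by apply: field_ext => p; exact: linearB. Qed.

Lemma aut_field_invK psi X : aut_field psi (aut_field (aut_inv psi) X) = X.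
Proof. by apply: field_ext => p; exact: aut_inv_funK. Qed.

Lemma aut_cov_aut_inv (nabla : connection M) psi X Y :
  aut_field psi (cov_aut nabla X (aut_inv psi) Y) =
  aut_field psi (nabla X (aut_field (aut_inv psi) Y)) - nabla X Y.
Proof. by rewrite aut_fieldB aut_field_invK. Qed.

Lemma twist_eval_aut (g : riemannian_metric M) psi X Y :
  metric_eval (metric_twist g psi) (aut_field psi X) Y =
  metric_eval g X (aut_field (aut_inv psi) Y).
Proof. by apply/val_inj/funext => p /=; rewrite aut_funK. Qed.

(** Both sides compute the derivative of [g(psi^-1 Y, psi^-1 Z)]: the
    connection that sends [Y] to [psi (nabla_X (psi^-1 Y))] is compatible with
    the twisted metric, and it differs from [nabla] by the [cov_aut] terms. *)
Lemma twist_derivative (g : riemannian_metric M) (nabla : connection M) :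
  metric_compatible g nabla -> forall psi (h := metric_twist g psi) X Y Z,
  field_act X (metric_eval h Y Z) =
    (metric_eval h (nabla X Y) Z + metric_eval h (nabla X Z) Y) +
    (metric_eval h (aut_field psi (cov_aut nabla X (aut_inv psi) Y)) Z +
     metric_eval h (aut_field psi (cov_aut nabla X (aut_inv psi) Z)) Y).
Proof.
move=> g_compat psi h X Y Z.
have -> : metric_eval h Y Z =
    metric_eval g (aut_field (aut_inv psi) Y) (aut_field (aut_inv psi) Z).
  exact/val_inj.
rewrite addrACA -!metric_evalDl !aut_cov_aut_inv ![nabla X _ + _]addrC !subrK.
by rewrite !twist_eval_aut g_compat [X in _ + X]metric_evalC.
Qed.

Lemma torsion_free_diff_sym (nabla nabla' : connection M) :
  torsion_free nabla -> torsion_free nabla' ->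
  forall X Y, nabla' X Y - nabla X Y = nabla' Y X - nabla Y X.
Proof.
move=> tf tf' X Y; apply/eqP.
rewrite subr_eq addrAC -addrA addrC -subr_eq; apply/eqP/field_ext => p.
by rewrite tf tf'.
Qed.

End Twist.

Theorem proposition2p1 (R : realType) (n : nat) (M : smooth_manifold R n)
    (g : riemannian_metric M) (psi : tangent_aut M)
    (h := metric_twist g psi)
    (nabla_g nabla_h : connection M)
    (nabla_g_LC : levi_civita g nabla_g)
    (nabla_h_LC : levi_civita h nabla_h) :
  (forall X Y Z : vector_field M,
    2 * metric_eval h (nabla_h X Y) Z =
      2 * metric_eval h (nabla_g X Y) Z
      + metric_eval h (aut_field psi (cov_aut nabla_g X (aut_inv psi) Y)) Z
      + metric_eval h (aut_field psi (cov_aut nabla_g Y (aut_inv psi) X)) Z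
      + metric_eval h (aut_field psi (cov_aut nabla_g X (aut_inv psi) Z)) Y
      - metric_eval h (aut_field psi (cov_aut nabla_g Z (aut_inv psi) X)) Y
      + metric_eval h (aut_field psi (cov_aut nabla_g Y (aut_inv psi) Z)) X
      - metric_eval h (aut_field psi (cov_aut nabla_g Z (aut_inv psi) Y)) X)
  /\
  ((forall X Y : vector_field M,
      cov_aut nabla_g X (aut_inv psi) Y = cov_aut nabla_g Y (aut_inv psi) X) ->
   forall X Y : vector_field M,
     nabla_h X Y = aut_field psi (nabla_g X (aut_field (aut_inv psi) Y))).
Proof.
have [tf_g compat_g] := nabla_g_LC; have [tf_h compat_h] := nabla_h_LC.
pose t X Y := metric_eval h (aut_field psi (cov_aut nabla_g X (aut_inv psi) Y)).
pose d X Y := metric_eval h (nabla_h X Y - nabla_g X Y).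
have dC X Y Z : d X Y Z = d Y X Z.
  by rewrite /d (torsion_free_diff_sym tf_g tf_h).
have dt X Y Z : d X Y Z + d X Z Y = t X Y Z + t X Z Y.
  have := twist_derivative compat_g psi X Y Z.
  rewrite compat_h [metric_eval _ Y _]metric_evalC => hE.
  by rewrite /d !metric_evalBl addrACA -opprD hE addrC addKr.
have koszul := koszul_polarization dC dt.
have hE X Y Z : metric_eval h (nabla_h X Y) Z =
    metric_eval h (nabla_g X Y) Z + d X Y Z.
  by rewrite -metric_evalDl addrC subrK.
split=> [X Y Z|A_sym X Y].
  rewrite !mulr_natl hE mulrnDl koszul opprD -!addrA; do 2 congr (_ + _).
  by congr (_ + _); rewrite addrCA; do 2 congr (_ + _); exact: addrCA.
have dE Z : d X Y Z = t X Y Z.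
  have tC X' Y' Z' : t X' Y' Z' = t Y' X' Z' by rewrite /t A_sym.
  (* [t] now satisfies the two identities that determine [d]. *)
  apply: Cinf_mulr2n_inj.
  by rewrite koszul -(koszul_polarization tC (fun _ _ _ => erefl)).
apply: subr0_eq; set V : vector_field M := _ - _.
have VE : V = nabla_h X Y - nabla_g X Y
    - aut_field psi (cov_aut nabla_g X (aut_inv psi) Y).
  by rewrite aut_cov_aut_inv opprB addrA subrK.
have VV : metric_eval h V V = 0.
  by rewrite {1}VE metric_evalBl -/(d X Y V) dE subrr.
exact: metric_eval_eq0 VV.
Qed.
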